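(* Let $G$ be a group and let $R\subseteq G$ be a rational subset of $G$. There is a virtually Abelian group $H$ and a finitely generated submonoid $M\le G\times H$ such that $R$ is a section of $M$, i.e. there is $h\in H$ with $R=\{g\in G\mid (g,h)\in M\}$. Moreover, $H$ depends only on the number of vertices of the graph defining $R$ (that is, $H$ can be chosen as a function of this number alone, independently of $G$ and of the rest of the description of $R$).
   Context: Rational subsets: a rational subset $R$ of a group $G$ is described by a finite $G$-labelled directed graph, i.e. a finite set $V$ of vertices (states), a finite set of transitions (edges) $S\subseteq V\times G\times V$, an initial state $v_0\in V$ and a set of accepting states in $V$. The subset defined by this graph is the set of all $g\in G$ that are the label of some path from the initial state to an accepting state, where the label of a path is the product, in order, of the labels of its edges (the empty path has label $1_G$). Sections: for a set $A\subseteq G\times H$ and $h\in H$, the $h$-section of $A$ is $\{g\in G\mid (g,h)\in A\}$. A section of $A$ is an $h$-section for some $h\in H$. *)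

(* Defs.v *)
From HB Require Import structures.
From mathcomp Require Import all_boot finmap.
From mathcomp Require Import boolp classical_sets functions cardinality.

Set Implicit Arguments.
Unset Strict Implicit.
Unset Printing Implicit Defensive.

Local Open Scope classical_set_scope.
Local Open Scope group_scope.

Record labelled_graph (G : groupType) := LabelledGraph {
  vertex : finType;
  edges : {fset vertex * G * vertex};
  initial : vertex;
  accepting : {set vertex}
}.

Section RationalSubset.
Variables (G : groupType) (A : labelled_graph G).

Fixpoint is_path (v : vertex A) (p : seq (vertex A * G * vertex A))
    (w : vertex A) : bool :=
  if p is (v1, g, v2) :: p' then
    [&& v1 == v, (v1, g, v2) \in edges A & is_path v2 p' w]
  else v == w.

Definition path_label (p : seq (vertex A * G * vertex A)) : G :=
  \prod_(e <- p) e.1.2.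

Definition defined_subset : set G :=
  [set g | exists p w,
     [/\ is_path (initial A) p w, w \in accepting A & path_label p = g]].

End RationalSubset.

Definition submonoid (K : groupType) (M : set K) : Prop :=
  monoid_closed [in M].

Definition finitely_generated_submonoid (K : groupType) (M : set K) : Prop :=
  exists X : {fset K}, M = smallest (@submonoid K) [set` X].

Definition subgroup (K : groupType) (B : set K) : Prop :=
  group_closed [in B].

(* The index of B in K is the number of its left cosets. *)
Definition finite_index (K : groupType) (B : set K) : Prop :=
  finite_set [set [set x * b | b in B] | x in [set: K]].

Definition virtually_abelian (K : groupType) : Prop :=
  exists B : set K,
    [/\ subgroup B, {in B &, forall x y, commute x y} & finite_index B].

(* Main.v *)
Require Import Defs.
From HB Require Import structures.
From mathcomp Require Import all_boot finmap.
From mathcomp Require Import ssralg ssrnum ssrint zmodp fingroup perm.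
From mathcomp Require Import boolp classical_sets functions cardinality.

Set Implicit Arguments.
Unset Strict Implicit.
Unset Printing Implicit Defensive.

Import GRing.Theory Num.Theory.

Local Open Scope classical_set_scope.

(** A section of a finitely generated submonoid consists of the labels of the words
in the generators whose second coordinate multiplies out to a given [h]. So the
second coordinates must be chosen such that a word reaches [h] only if its
letters spell an accepting path. The group used is the wreath product of the integers
by the symmetric group of a finite set of places, with [n] states giving three
rows of [n] places and one extra place [None].

An element [(f, s)] of the wreath product is best seen as a move in a game with
one token per place: the token on place [x] earns [f x] and goes to [s x]. In a
product the moves are played from left to right, and the value of the product
records, for every token, its total earnings and its final place. The order in
which moves are played matters only through where the tokens stand, which is
what lets an otherwise abelian bookkeeping see the order of the letters.

There are three kinds of generators.
- [Step (u, g, v)], for an edge, has label [g]; the token on [(u, 0)] earns 1,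
  and the tokens on [(u, 0)] and [(v, 0)] are exchanged.
- [Pay] has trivial label; the token on [(v0, 1)] loses 1, where [v0] is the
  initial state. Nothing moves.
- [Stop s] has trivial label; the token on [None] earns 1, and the tokens move
  by [s^-1 * row_shift], where [row_shift] sends row [k] to row [k + 1] modulo
  3. Here [s] is any permutation that fixes [None] and sends [(v0, 0)] to some
  [(w, 0)] with [w] accepting.

The [target] [h] asks that the tokens have moved by [row_shift], that the token
of [None] has earned 1 and that all others have earned 0.

A path from [v0] to [w] yields a word with value [h] ([outcome_complete]): along
the path the token of [(v0, 0)] follows the current state and takes all the
earnings; [Stop s], with [s] the permutation achieved so far, puts it on
[(v0, 1)] and every other token where it belongs; enough [Pay] moves then bring
its earnings back to 0.

Conversely, let a word have value [h] ([outcome_sound]). The token of [None]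
counts the [Stop] moves, so there is exactly one. Only [Stop] moves tokens
between rows, and this makes each row of tokens do one job. The token starting
on [(v0, 1)] loses 1 at each [Pay] before the [Stop], and can earn nothing
afterwards, so there is no such [Pay]. The tokens of row 2 sit in row 0 after
the [Stop], where they cannot lose, so there is no [Step] there. Hence the word
is [Step ... Step, Stop, Pay ... Pay], and the final [Pay] moves can compensate
only the token which started on [(v0, 0)]; every [Step] is therefore applied to
this very token, that is, the edges form a path from [v0]
([path_of_steps]). The condition that the permutation be [row_shift] forces this
path to end at the accepting state prescribed by the [Stop] move. *)

(** * Words *)

Lemma smallest_submonoidE (K : groupType) (X : set K) :
  smallest (@submonoid K) X =
  [set z | exists2 w : seq K, (forall x, x \in w -> X x) &
                              z = (\prod_(x <- w) x)%g].
Proof.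
apply/seteqP; split.
  apply: smallest_sub; last first.
    move=> x Xx; exists [:: x]; last by rewrite big_seq1.
    by move=> y; rewrite inE => /eqP ->.
  split; first by rewrite inE; exists [::]; rewrite ?big_nil.
  move=> x y; rewrite !inE => -[w Xw ->] [w' Xw' ->].
  exists (w ++ w'); last by rewrite big_cat.
  by move=> z; rewrite mem_cat => /orP[/Xw|/Xw'].
move=> _ [w Xw ->] M [[M1 MM] XM].
suff: (\prod_(x <- w) x)%g \in M by rewrite inE.
elim: w Xw => [|x w IH] Xw; first by rewrite big_nil.
rewrite big_cons; apply: MM.
  by rewrite inE; apply: XM; apply: Xw; rewrite inE eqxx.
by apply: IH => y yw; apply: Xw; rewrite inE yw orbT.
Qed.

Lemma smallest_submonoid (K : groupType) (X : set K) :
  submonoid (smallest (@submonoid K) X).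
Proof.
split; first by rewrite inE => M [[]]; rewrite inE.
move=> x y; rewrite !inE => Mx My M MX; have [[_ MM] _] := MX.
by have := MM x y; rewrite !inE; apply; [apply: Mx | apply: My].
Qed.

Lemma count1_split (X : Type) (a : pred X) (s : seq X) : count a s = 1 ->
  exists s1 x s2, [/\ s = s1 ++ x :: s2, a x,
                      all (predC a) s1 & all (predC a) s2].
Proof.
elim: s => [|x s IH] //=; case: (boolP (a x)) => ax /=.
  rewrite add1n => -[/eqP]; rewrite -leqn0 leqNgt -has_count -all_predC => s0.
  by exists [::], x, s.
rewrite add0n => /IH[s1 [y [s2 [-> ay s1a s2a]]]].
by exists (x :: s1), y, s2; rewrite /= ax.
Qed.

(** * The wreath product of the integers by a symmetric group *)

Section Wreath.
Variable T : finType.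
Implicit Types (x y : T).

Definition wreath : Type := {ffun T -> int} * {perm T}.
HB.instance Definition _ := Choice.on wreath.

Definition earning (h : wreath) : {ffun T -> int} := h.1.
Definition motion (h : wreath) : {perm T} := h.2.

Definition wreath_one : wreath := ([ffun=> 0%R], 1%g).
(** The product [s * t] of permutations plays [s] first, so in [h * k] the token
starting on [x] is on [motion h x] when [k] is played. *)
Definition wreath_mul (h k : wreath) : wreath :=
  ([ffun x => earning h x + earning k (motion h x)]%R,
   (motion h * motion k)%g).
Definition wreath_inv (h : wreath) : wreath :=
  ([ffun x => - earning h ((motion h)^-1%g x)]%R, (motion h)^-1%g).

Lemma wreath_eq (h k : wreath) :
  (forall x, earning h x = earning k x) -> motion h = motion k -> h = k.
Proof. by case: h k => [f s] [g t] /= /ffunP -> ->. Qed.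

Fact wreath_mulA : associative wreath_mul.
Proof.
move=> h k l; apply: wreath_eq => [x|] /=; last exact: mulgA.
by rewrite !ffunE /= permM addrA.
Qed.

Fact wreath_mul1 : left_id wreath_one wreath_mul.
Proof.
move=> h; apply: wreath_eq => [x|] /=; last exact: mul1g.
by rewrite !ffunE /= perm1 add0r.
Qed.

Fact wreath_mulr1 : right_id wreath_one wreath_mul.
Proof.
move=> h; apply: wreath_eq => [x|] /=; last exact: mulg1.
by rewrite !ffunE /= addr0.
Qed.

Fact wreath_mulV : left_inverse wreath_one wreath_inv wreath_mul.
Proof.
move=> h; apply: wreath_eq => [x|] /=; last exact: mulVg.
by rewrite !ffunE /= addNr.
Qed.

Fact wreath_mulrV : right_inverse wreath_one wreath_inv wreath_mul.
Proof.
move=> h; apply: wreath_eq => [x|] /=; last exact: mulgV.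
by rewrite !ffunE /= permK subrr.
Qed.

HB.instance Definition _ := isGroup.Build wreath
  wreath_mulA wreath_mul1 wreath_mulr1 wreath_mulV wreath_mulrV.

Lemma earning1 x : earning (1%g : wreath) x = 0%R.
Proof. by rewrite ffunE. Qed.

Lemma earningM (h k : wreath) x :
  earning (h * k)%g x = (earning h x + earning k (motion h x))%R.
Proof. by rewrite ffunE. Qed.

Lemma motionM (h k : wreath) : motion (h * k)%g = (motion h * motion k)%g.
Proof. by []. Qed.

(** The functions into the integers, that is, the elements without motion, form
an abelian subgroup whose cosets are the fibres of [motion], finitely many. *)
Lemma wreath_virtually_abelian : virtually_abelian wreath.
Proof.
pose B : set wreath := [set h | motion h = 1%g].
have BP h : (h \in B) = (motion h == 1%g).
  by apply/idP/eqP; rewrite inE.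
exists B; split.
- split; first by rewrite BP.
  move=> h k; rewrite !BP => /eqP mh /eqP mk.
  by rewrite motionM mh mul1g /= mk invg1.
- move=> h k; rewrite !BP => /eqP mh /eqP mk; apply: wreath_eq => [x|].
    by rewrite !earningM mh mk !perm1 addrC.
  by rewrite !motionM mh mk.
- apply: (@sub_finite_set _ _
      [set [set h | motion h = s] | s in [set: {perm T}]]).
    move=> _ [h _ <-]; exists (motion h) => //.
    apply/seteqP; split => [k mk | _ [b Bb <-]].
      exists (h^-1 * k)%g; last by rewrite mulKVg.
      by rewrite /B /mkset motionM (mk : motion k = motion h) mulVg.
    by rewrite /mkset motionM (Bb : motion b = 1%g) mulg1.
  exact/finite_image/finite_finset.
Qed.

End Wreath.

(** * The places and the target *)

(** [Some (i, k)] is the copy of state [i] in row [k], and [None] counts the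
[Stop] moves. *)
Definition place n := option ('I_n * 'I_3).

Section Places.
Variable n : nat.

Definition ground (x : place n) : bool :=
  if x is Some (_, k) then k == 0%R else false.

Definition next_row (x : place n) : place n :=
  omap (fun p => (p.1, p.2 + 1))%R x.

Fact next_row_inj : injective next_row.
Proof.
move=> [[i k]|] [[j l]|] // /(@Some_inj _)/eqP.
by rewrite xpair_eqE => /andP[/eqP /= -> /eqP/(@addIr _ 1%R) ->].
Qed.

Definition row_shift : {perm place n} := perm next_row_inj.

Definition target : wreath (place n) :=
  ([ffun x => (x == None)%:R%R], row_shift).

Lemma row_shiftE x : row_shift x = next_row x.
Proof. by rewrite permE. Qed.

End Places.

(** * The moves *)

Section Generators.
Variables (G : groupType) (A : labelled_graph G).
Local Notation V := (vertex A).
Local Notation T := (place #|V|).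
Local Notation edge := (V * G * V)%type.
Local Notation K := (G * wreath T)%type.
Implicit Types (x y : T) (u v : V) (e : edge).

Definition station v (k : 'I_3) : T := Some (enum_rank v, k).
Local Notation booth := (station (initial A) 1%R).

Lemma station_eq u v k l : (station u k == station v l) = (u == v) && (k == l).
Proof.
by rewrite (inj_eq (@Some_inj _)) xpair_eqE (inj_eq enum_rank_inj).
Qed.

(** Moves are data rather than group elements, so that the kind of a letter,
which the arguments below count and compare, can be read off it. *)
Inductive move := Step of edge | Pay | Stop of {perm T}.

Definition value (m : move) : K :=
  match m with
  | Step (u, g, v) =>
      (g, ([ffun x => (x == station u 0)%:R]%R,
           tperm (station u 0%R) (station v 0%R)))
  | Pay => (1%g, ([ffun x => - (x == booth)%:R]%R, 1%g))
  | Stop s =>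
      (1%g, ([ffun x => (x == None)%:R]%R, (s^-1 * row_shift #|V|)%g))
  end.

Definition legal (m : move) : bool :=
  match m with
  | Step e => e \in edges A
  | Pay => true
  | Stop s => (s None == None) &&
      [exists w in accepting A, s (station (initial A) 0%R) == station w 0%R]
  end.

Definition is_step m := if m is Step _ then true else false.
Definition is_pay m := if m is Pay then true else false.
Definition is_stop m := if m is Stop _ then true else false.

Definition outcome (w : seq move) : K := (\prod_(m <- w) value m)%g.
Definition label w : G := (outcome w).1.
Definition earned w x : int := earning (outcome w).2 x.
Definition moved w : {perm T} := motion (outcome w).2.

Lemma outcome_cat w1 w2 : outcome (w1 ++ w2) = (outcome w1 * outcome w2)%g.
Proof. exact: big_cat. Qed.

Lemma outcome_cons m w : outcome (m :: w) = (value m * outcome w)%g.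
Proof. exact: big_cons. Qed.

Lemma label_cat w1 w2 : label (w1 ++ w2) = (label w1 * label w2)%g.
Proof. by rewrite /label outcome_cat. Qed.

Lemma earned_cat w1 w2 x :
  earned (w1 ++ w2) x = (earned w1 x + earned w2 (moved w1 x))%R.
Proof. by rewrite /earned outcome_cat earningM. Qed.

Lemma moved_cat w1 w2 : moved (w1 ++ w2) = (moved w1 * moved w2)%g.
Proof. by rewrite /moved outcome_cat. Qed.

Lemma label_cons m w : label (m :: w) = ((value m).1 * label w)%g.
Proof. by rewrite /label outcome_cons. Qed.

Lemma earned_cons m w x :
  earned (m :: w) x =
    (earning (value m).2 x + earned w (motion (value m).2 x))%R.
Proof. by rewrite /earned outcome_cons earningM. Qed.

Lemma moved_cons m w : moved (m :: w) = (motion (value m).2 * moved w)%g.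
Proof. by rewrite /moved outcome_cons. Qed.

Lemma label_nil : label [::] = 1%g.
Proof. by rewrite /label /outcome big_nil. Qed.

Lemma earned_nil x : earned [::] x = 0%R.
Proof. by rewrite /earned /outcome big_nil earning1. Qed.

Lemma moved_nil : moved [::] = 1%g.
Proof. by rewrite /moved /outcome big_nil. Qed.

(** * Words without a stop *)

(** Legal motions fix [None], so its token is there for every [Stop]. *)
Lemma earned_None w : all legal w ->
  earned w None = (count is_stop w)%:R%R.
Proof.
elim: w => [|m w IH]; first by rewrite earned_nil.
rewrite earned_cons => /andP[lm /IH {}IH] /=; rewrite natrD.
case: m lm => [[[u g] v] _||s /andP[/eqP sN _]] /=.
- by rewrite ffunE /= tpermD ?IH.
- by rewrite ffunE /= perm1 IH oppr0.
- by rewrite ffunE eqxx permM -{1}sN permK row_shiftE IH.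
Qed.

Lemma ground_tperm u v x :
  ground (tperm (station u 0%R) (station v 0%R) x) = ground x.
Proof. by case: tpermP => // ->. Qed.

Lemma moved_upper w x : all (predC is_stop) w -> ~~ ground x -> moved w x = x.
Proof.
elim: w => [|m w IH] /=; first by rewrite moved_nil perm1.
rewrite moved_cons permM => /andP[nm /IH {}IH] gx.
case: m nm => [[[u g] v] _|_|s] //=; last by rewrite perm1 IH.
by rewrite tpermD ?IH //; apply: contra gx => /eqP <-.
Qed.

Lemma moved_ground w x : all (predC is_stop) w -> ground (moved w x) = ground x.
Proof.
elim: w x => [|m w IH] x /=; first by rewrite moved_nil perm1.
rewrite moved_cons permM => /andP[nm /IH ->].
by case: m nm => [[[u g] v] _|_|s] //=; rewrite ?ground_tperm ?perm1.
Qed.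

Lemma earned_upper w x : all (predC is_stop) w -> ~~ ground x ->
  earned w x = (- (count is_pay w)%:R *+ (x == booth))%R.
Proof.
elim: w => [|m w IH] /=; first by rewrite earned_nil oppr0 mul0rn.
rewrite earned_cons => /andP[nm /IH {}IH] gx.
case: m nm => [[[u g] v] _|_|s] //=; rewrite ffunE.
  have nst a : station a 0%R != x.
    by apply: contra gx => /eqP <-.
  by rewrite eq_sym (negbTE (nst u)) add0r tpermD ?IH ?nst.
by rewrite perm1 IH // natrD opprD mulrnDl; case: (x == booth).
Qed.

(** A token of row 0 stays there and [Pay] charges row 1 only, so it never loses. *)
Lemma earned_ground_ge0 w x : all (predC is_stop) w -> ground x ->
  (0 <= earned w x)%R.
Proof.
elim: w x => [|m w IH] x /=; first by rewrite earned_nil.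
rewrite earned_cons => /andP[nm /IH {}IH] gx.
case: m nm => [[[u g] v] _|_|s] //=; rewrite ffunE.
  by rewrite addr_ge0 ?IH ?ground_tperm ?ler0n.
rewrite perm1; have -> : x == booth = false by apply: contraTF gx => /eqP ->.
by rewrite oppr0 add0r IH.
Qed.

(** Some token stands on the source of the first [Step] and earns 1 there; no
loss can make up for it. *)
Lemma earned_ground_eq0 w : all (predC is_stop) w ->
  (forall x, ground x -> earned w x = 0%R) -> all is_pay w.
Proof.
elim: w => [|m w IH] //= /andP[nm nw] w0.
case: m nm w0 => [[[u g] v] _|_|s] //= w0.
  have := w0 (station u 0%R) isT.
  rewrite earned_cons /= ffunE eqxx => /eqP; rewrite paddr_eq0 ?ler01 //.
  by apply: earned_ground_ge0 => //; rewrite ground_tperm.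
apply: IH => // x gx; have := w0 x gx; rewrite earned_cons /= ffunE perm1.
have -> : x == booth = false by apply: contraTF gx => /eqP ->.
by rewrite oppr0 add0r.
Qed.

(** The token starting on [(v, 0)] plays the current state. A [Step] whose source
is not the current state would reward another token of row 0, which the
hypothesis forbids since nothing is lost in row 0. *)
Lemma path_of_steps w v : all legal w -> all is_step w ->
  (forall x, ground x -> x != station v 0%R -> earned w x = 0%R) ->
  exists p v', [/\ is_path v p v', moved w (station v 0%R) = station v' 0%R
                 & path_label p = label w].
Proof.
elim: w v => [|m w IH] v /=.
  exists [::], v; rewrite moved_nil perm1 label_nil /path_label big_nil /=.
  by rewrite eqxx.
move=> /andP[lm lw] /andP[sm sw] w0.
case: m lm sm w0 => [[[u g] u'] /= lm _ w0| |] //.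
have nsw : all (predC is_stop) w by apply: sub_all sw => -[].
have [uv|uv] := eqVneq u v; last first.
  have := w0 (station u 0%R) isT; rewrite station_eq (negbTE uv) => /(_ isT) /eqP.
  rewrite earned_cons /= ffunE eqxx paddr_eq0 ?ler01 //.
  by apply: earned_ground_ge0 => //; rewrite ground_tperm.
subst u.
(* After the first step the distinguished token stands on [(u', 0)]; the other
   tokens are tracked back through the transposition. *)
case: (IH u') => //.
  move=> x gx xu'; set t := tperm (station v 0%R) (station u' 0%R).
  have txv : t x != station v 0%R.
    by apply: contra xu' => /eqP /(canRL (tpermK _ _)) ->; rewrite tpermL.
  have := w0 (t x); rewrite ground_tperm => /(_ gx txv).
  by rewrite earned_cons /= ffunE (negbTE txv) add0r tpermK.
move=> p [v' [pp mp lp]]; exists ((v, g, u') :: p), v'; split.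
- by rewrite /= eqxx lm.
- by rewrite moved_cons permM /= tpermL.
- by rewrite label_cons -lp /path_label big_cons.
Qed.

Lemma outcome_of_path p v v' : is_path v p v' ->
  let w := map Step p in
  [/\ all legal w, label w = path_label p,
      forall x, earned w x = ((x == station v 0%R) * size p)%:R%R,
      moved w (station v 0%R) = station v' 0%R & moved w None = None].
Proof.
elim: p v => [|[[u g] u'] p IH] v /=.
  move=> /eqP <-; rewrite moved_nil !perm1 label_nil /path_label big_nil.
  by split=> // x; rewrite earned_nil muln0.
move=> /and3P[/eqP -> lm /IH[lw ll ew mw mN]]; split.
- by rewrite lm.
- by rewrite label_cons ll /path_label big_cons.
- move=> x; rewrite earned_cons ew /= ffunE -natrD; congr (_%:R)%R.
  have -> : (tperm (station v 0%R) (station u' 0%R) x == station u' 0%R)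
            = (x == station v 0%R).
    by rewrite -{2}(tpermL (station v 0%R) (station u' 0%R)) (inj_eq perm_inj).
  by case: (_ == _).
- by rewrite moved_cons permM /= tpermL.
- by rewrite moved_cons permM /= tpermD.
Qed.

Lemma outcome_pays w : all is_pay w ->
  [/\ label w = 1%g, moved w = 1%g &
      forall x, earned w x = (- ((x == booth) * size w)%:R)%R].
Proof.
elim: w => [|[|//|] w IH] //=.
  by split=> [||x]; rewrite ?label_nil ?moved_nil // earned_nil muln0 oppr0.
move=> /IH[lw mw ew]; split; rewrite ?label_cons ?moved_cons ?lw ?mw ?mulg1 //.
move=> x; rewrite earned_cons ew /= ffunE perm1 -opprD -natrD.
by case: (_ == _).
Qed.

(** * Words whose value is the target *)

(** Tokens of row 0 are in row 1 after the [Stop]; this singles out the only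
one that [Pay] can charge then. *)
Lemma next_row_booth x : (next_row x == booth) = (x == station (initial A) 0%R).
Proof.
exact: (@inj_eq _ _ _ (@next_row_inj #|V|) _ (station (initial A) 0%R)).
Qed.

Lemma outcome_complete g : defined_subset A g ->
  exists2 w, all legal w & outcome w = (g, target #|V|).
Proof.
move=> [p [v' [/outcome_of_path [] lw ll ew mw mN acc pg]]].
set w := map Step p in lw ll ew mw mN.
exists (w ++ Stop (moved w) :: nseq (size p) Pay).
  rewrite all_cat lw /= mN eqxx all_nseq orbT andbT /=.
  by apply/existsP; exists v'; rewrite acc mw eqxx.
have [|lp mp ep] := @outcome_pays (nseq (size p) Pay).
  by rewrite all_nseq orbT.
rewrite [LHS]surjective_pairing; congr pair.
  by rewrite -/(label _) label_cat label_cons ll lp /= !mulg1.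
apply: wreath_eq => [x|]; last first.
  by rewrite -/(moved _) moved_cat moved_cons mp /= mulg1 mulKVg.
rewrite -/(earned _ x) earned_cat earned_cons ew ep /= !ffunE permM permK.
rewrite row_shiftE size_nseq.
have -> : (moved w x == None) = (x == None).
  by rewrite -{1}mN (inj_eq perm_inj).
by rewrite next_row_booth addrC subrK.
Qed.

(** The three rows of tokens are used in turn: row 1 to exclude an early [Pay],
row 2 to exclude a late [Step], row 0 to check the path. *)
Lemma outcome_sound w g : all legal w -> outcome w = (g, target #|V|) ->
  defined_subset A g.
Proof.
move=> lw ow.
have ew x : earned w x = (x == None)%:R%R.
  by rewrite /earned ow /= ffunE.
have mw : moved w = row_shift #|V| by rewrite /moved ow.
have lbl : label w = g by rewrite /label ow.
have : count is_stop w = 1.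
  by have /eqP := ew None; rewrite earned_None // eqxx eqr_nat => /eqP.
case/count1_split => w1 [[e||s] [w2 [ws // _ ns1 ns2]]].
move: lw; rewrite ws all_cat /= => /and3P[lw1 /andP[_ sacc] lw2].
have ms : (moved w1 * (s^-1 * row_shift #|V|) * moved w2)%g = row_shift #|V|.
  apply: esym; rewrite -{1}mw ws moved_cat moved_cons; exact: mulgA.
(* [t x] is the place, just after the [Stop], of the token starting on [x]. *)
pose t x := (s^-1 * row_shift #|V|)%g (moved w1 x).
have tE x : moved w2 (t x) = next_row x.
  by rewrite -row_shiftE -[in RHS]ms !permM /t permM.
have t_upper x : ~~ ground (next_row x) -> t x = next_row x.
  by move=> gx; rewrite -(tE x) moved_upper // -(moved_ground _ ns2) tE.
have balance x : x != None -> (earned w1 x + earned w2 (t x) = 0)%R.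
  move=> xN; have := ew x; rewrite ws earned_cat earned_cons /= ffunE.
  have -> : (moved w1 x == None) = false.
    rewrite -(negbTE xN); apply/eqP/eqP => [m1x|->]; last exact: moved_upper.
    by apply: (@perm_inj _ (moved w1)); rewrite m1x moved_upper.
  by rewrite (negbTE xN) add0r.
(* The token of the booth loses 1 at each [Pay] before the [Stop], and earns
   nothing in row 2 afterwards. *)
have steps1 : all is_step w1.
  have := balance booth isT.
  have -> : t booth = station (initial A) 2%:R%R by rewrite t_upper.
  rewrite !earned_upper // eqxx station_eq eqxx mulr0n addr0.
  move=> /eqP; rewrite oppr_eq0 pnatr_eq0 -leqn0 leqNgt -has_count => np1.
  have : all (predC is_pay) w1 && all (predC is_stop) w1 by rewrite all_predC np1.
  by rewrite -all_predI; apply: sub_all => -[].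
(* The tokens on row 0 after the [Stop] come from row 2, where they earned
   nothing; so they earn nothing after the [Stop] either. *)
have pays2 : all is_pay w2.
  apply: earned_ground_eq0 => // y gy.
  have [x xE] : exists x, next_row x = moved w2 y.
    by exists ((row_shift _)^-1%g (moved w2 y)); rewrite -row_shiftE permKV.
  have yE : y = t x by apply: (@perm_inj _ (moved w2)); rewrite tE.
  have gx : ground (next_row x) by rewrite xE moved_ground.
  case: x gx {xE} yE => [[i k]|] //= /eqP k1 yE.
  have k2 : k = 2%:R%R by apply/(addIr 1%R); rewrite k1; apply: val_inj.
  have := balance (Some (i, k)) isT.
  rewrite -yE k2 earned_upper // (inj_eq (@Some_inj _)) xpair_eqE andbF mulr0n.
  by rewrite add0r.
(* The [Pay] moves move nothing, so the motion was already complete at the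
   [Stop]: the steps must have achieved exactly [s]. *)
have [lp mp ep] := outcome_pays pays2.
have m1E x : moved w1 x = s x.
  have /perm_inj : row_shift _ (s^-1%g (moved w1 x)) = row_shift _ x.
    by rewrite [RHS]row_shiftE -tE mp perm1 /t permM.
  by move=> sm; rewrite -{2}sm permKV.
(* After the [Stop], only the token starting on the initial state of row 0 can
   be charged, so no other token of row 0 earned anything before. *)
have idle x : ground x -> x != station (initial A) 0%R -> earned w1 x = 0%R.
  move=> gx xi; have xN : x != None by case: (x) gx.
  have := balance x xN; rewrite ep -(perm1 (t x)) -mp tE next_row_booth.
  by rewrite (negbTE xi) mul0n oppr0 addr0.
have [p [v' [pp mv pl]]] := path_of_steps lw1 steps1 idle.
exists p, v'; split=> //; last first.
  by rewrite pl -lbl ws label_cat label_cons lp /= !mulg1.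
case/existsP: sacc => [a /andP[aA]].
by rewrite -m1E mv station_eq => /andP[/eqP -> _].
Qed.

(** * The generated submonoid *)

Definition generators : set K := value @` [set m | legal m].

Lemma finite_generators : finite_set generators.
Proof.
pose steps := [set Step e | e in [set` edges A]].
pose stops := [set Stop s | s in [set: {perm T}]].
apply: (@sub_finite_set _ _ (value @` (steps `|` [set Pay] `|` stops))).
  apply: image_subset => -[e||s] /= lm.
  - by left; left; exists e.
  - by left; right.
  - by right; exists s.
apply: finite_image; rewrite !finite_setU; split; [split|].
- exact/finite_image/finite_fset.
- exact: finite_set1.
- exact/finite_image/finite_finset.
Qed.

Lemma generated_outcomes z : smallest (@submonoid K) generators z <->
  exists2 w, all legal w & outcome w = z.
Proof.
rewrite smallest_submonoidE; split=> [[w Xw ->]|[w lw <-]].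
  elim: w Xw => [|k w IH] Xw; first by exists [::]; rewrite // /outcome !big_nil.
  have [m lm vm] : generators k by apply: Xw; exact: mem_head.
  have [v lv ov] : exists2 v, all legal v & outcome v = (\prod_(k <- w) k)%g.
    by apply: IH => l lw; apply: Xw; rewrite inE lw orbT.
  by exists (m :: v); rewrite /= ?lm // outcome_cons vm ov big_cons.
exists (map value w); last by rewrite big_map.
elim: w lw => [|m w IH] //= /andP[lm /IH {}IH] k.
by rewrite inE => /orP[/eqP -> | /IH //]; exists m.
Qed.

End Generators.

Theorem theorem5 :
  exists H : nat -> groupType,
    (forall n : nat, virtually_abelian (H n)) /\
    forall (G : groupType) (R : set G) (A : labelled_graph G),
      R = defined_subset A ->
      exists M : set (G * H #|vertex A|)%type,
        [/\ submonoid M, finitely_generated_submonoid M &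
            exists h : H #|vertex A|, R = ysection M h].
Proof.
exists (fun n => wreath (place n)); split=> [n|G R A ->].
  exact: wreath_virtually_abelian.
exists (smallest (@submonoid _) (@generators G A)); split.
- exact: smallest_submonoid.
- have /finite_fsetP[X XE] := finite_generators A.
  by exists X; rewrite -XE.
- exists (target #|vertex A|); apply/seteqP; split=> g; rewrite ysectionP.
    by rewrite generated_outcomes; apply: outcome_complete.
  by rewrite generated_outcomes => -[w]; apply: outcome_sound.
Qed.
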